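(* Let $(\beta,F_A,F_B)$ be a labor market ($\beta\ge1$) such that every core outcome under EPSW exhibits full segregation by group. Suppose there is an EPSW restriction. 1. There exist a continuum of pairwise non-equivalent core outcomes under EPSW. 2. Let $\beta>1$. There exists one core outcome under EPSW (unique up to equivalence) that yields the same wage gap as the core outcomes without EPSW. In all other (non-equivalent) core outcomes under EPSW, the wage gap is strictly larger. 3. Let $\beta>1$. For any two core outcomes under EPSW, the wage gap is larger in the first outcome than in the second if and only if firm profit is higher in the first outcome than in the second. 4. Let $\beta\,\mathbb{E}_A[v]>\mathbb{E}_B[v]$. Then, for any $\beta\ge1$, the following hold. (a) There exists one core outcome under EPSW (unique up to equivalence) that yields the same wage ratio as the core outcomes without EPSW, and in all other (non-equivalent) core outcomes under EPSW the wage ratio is strictly larger. (b) For any two core outcomes under EPSW, the wage ratio is larger in the first outcome than in the second if and only if firm profit is higher in the first outcome than in the second.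
   Context: Labor market. There are two firms, 1 and 2, and a continuum of workers. A worker has a type $(g,v)\in\{A,B\}\times[0,1]$ ($g$ = group, $v$ = productivity). There is a measure $\beta\ge 1$ of $A$-group workers and measure $1$ of $B$-group workers. Productivities in group $g$ are distributed with cdf $F_g$ on $[0,1]$, absolutely continuous with density $f_g$ satisfying $0<\inf_{v\in[0,1]} f_g(v)\le \sup_{v\in[0,1]} f_g(v)<\infty$. Write $\mathbb{E}_g[v]=\int_0^1 v f_g(v)\,dv$. A (labor) market is a tuple $(\beta,F_A,F_B)$. Outcomes. An outcome for firm $i$ is $O_i=\{(f_g^i(v),w_i^g(v))\}_{v\in[0,1],\,g=A,B}$ with $f_g^i(v)\in[0,f_g(v)]$ (density of type-$(g,v)$ workers hired by $i$) and $w_i^g(v)\in[0,\infty)$ (wage paid by $i$ to them), where $w_i^g(v)=0$ by convention whenever $f_g^i(v)=0$; all these functions are measurable in $v$. Under EPSW (''equal pay for similar work'') an outcome for firm $i$ must in addition satisfy: there exist no group $g$ (with $-g$ the other group) and no sets $V_g,V_{-g}\subset[0,1]$ of positive Lebesgue measure such that $f_g^i(v)>0$ for all $v\in V_g$, $f_{-g}^i(v)>0$ for all $v\in V_{-g}$, and $\inf_{v\in V_{-g}}w_i^{-g}(v)>\sup_{v\in V_g}w_i^g(v)$. An outcome is a pair $O=(O_1,O_2)$ of outcomes for the firms with $f_g^1(v)+f_g^2(v)\le f_g(v)$ for all $v,g$. Firm $i$'s profit is $$\pi_i^{O}=\pi_i^{O_i}=\beta\int_0^1[v-w_i^A(v)]f_A^i(v)\,dv+\int_0^1[v-w_i^B(v)]f_B^i(v)\,dv.$$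 Equivalence. Two outcomes $O_i,\tilde O_i$ for a firm are equivalent if, for each $g$, $f_g^i(v)=\tilde f_g^i(v)$ and $w_i^g(v)=\tilde w_i^g(v)$ for almost all $v$. Two outcomes $O,\tilde O$ are equivalent if either $O_i$ is equivalent to $\tilde O_i$ for both $i$, or $O_1$ is equivalent to $\tilde O_2$ and $O_2$ is equivalent to $\tilde O_1$ (relabeling firms). Blocking and core. An outcome $O$ is blocked by firm $j$ via an outcome for $j$, $\tilde O_j=\{(\tilde f_g^j(v),\tilde w_j^g(v))\}_{v,g}$, if $\pi_j^{\tilde O_j}>\pi_j^{O_j}$ and, for each $g\in\{A,B\}$ and almost all $v\in[0,1]$, at least one of the following holds ($-j$ denotes the other firm): (1) $\tilde w_j^g(v)\ge w_j^g(v)$ and $\tilde w_j^g(v)>w_{-j}^g(v)$; (2) $\tilde w_j^g(v)\ge w_j^g(v)$ and $\tilde f_g^j(v)+f_g^{-j}(v)\le f_g(v)$; (3) $\tilde w_j^g(v)>w_{-j}^g(v)$ and $\tilde f_g^j(v)+f_g^j(v)\le f_g(v)$; (4) $\tilde f_g^j(v)+f_g^j(v)+f_g^{-j}(v)\le f_g(v)$. A core outcome is an outcome not blocked by any firm via any outcome for that firm. In the core under EPSW, both the outcome and the blocking outcomes must satisfy the EPSW restriction; in the core without EPSW, the EPSW restriction is dropped everywhere. Full segregation. An outcome exhibits full segregation by group if for some $i\in\{1,2\}$, $f_A^i(v)=f_A(v)$ and $f_B^{-i}(v)=f_B(v)$ for almost all $v\in[0,1]$, firm $i$ hiring almost all $A$-group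 workers and firm $-i$ almost all $B$-group workers. Wage gap and wage ratio. For an outcome $O$ and group $g$, $AW_g^O=\int_0^1 w_1^g(v)f_g^1(v)\,dv+\int_0^1 w_2^g(v)f_g^2(v)\,dv$. The wage gap in $O$ is $AW_A^O-AW_B^O$. For $(AW_A^O,AW_B^O)\ne(0,0)$, the wage ratio in $O$ is $AW_A^O/AW_B^O$ if $AW_B^O\neq0$, and $+\infty$ if $AW_A^O>AW_B^O=0$. All core outcomes without EPSW have the same wage gap, $\mathbb{E}_A[v]-\mathbb{E}_B[v]$, and the same wage ratio, $\mathbb{E}_A[v]/\mathbb{E}_B[v]$. Firm profit. In any core outcome $O$ (with or without EPSW) $\pi_1^O=\pi_2^O$; ''firm profit'' refers to this common value. ''Almost all'' is with respect to Lebesgue measure. *)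

(* Defs.v *)
From HB Require Import structures.
From mathcomp Require Import all_boot all_order all_algebra.
From mathcomp Require Import all_classical all_reals all_analysis.

Set Implicit Arguments.
Unset Strict Implicit.
Unset Printing Implicit Defensive.

Import Order.TTheory GRing.Theory Num.Theory.
Import numFieldNormedType.Exports.

Local Open Scope classical_set_scope.
Local Open Scope ring_scope.

Variant group := GA | GB.
Definition other_group (g : group) : group := if g is GA then GB else GA.

Variant firm := Firm1 | Firm2.
Definition other_firm (i : firm) : firm := if i is Firm1 then Firm2 else Firm1.

(* All functions of a productivity are total on R, but only their restriction
   to [0, 1] is ever constrained or used. *)
Definition prod_range (R : realType) : set R := `[0, 1].
Arguments prod_range R : clear implicits.

Definition for_almost_all (R : realType) (P : R -> Prop) : Prop :=
  {ae @lebesgue_measure R, forall v, prod_range R v -> P v}.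

(* The density is part of the data because hiring densities are bounded
   pointwise by this version of it. *)
Record market (R : realType) := Market {
  beta : R;
  prod_cdf : group -> R -> R;
  dens : group -> R -> R;
  beta_ge1 : 1 <= beta;
  dens_measurable : forall g, measurable_fun (prod_range R) (dens g);
  dens_inf_gt0 : forall g,
    (0 < ereal_inf [set (dens g v)%:E | v in prod_range R])%E;
  dens_sup_lty : forall g,
    (ereal_sup [set (dens g v)%:E | v in prod_range R] < +oo)%E;
  prod_cdf_dens : forall g v, prod_range R v ->
    (prod_cdf g v)%:E = (\int[lebesgue_measure]_(u in `[0%R, v]) (dens g u)%:E)%E;
  prod_cdf1 : forall g, prod_cdf g 1 = 1
}.

Definition mean_prod (R : realType) (M : market R) (g : group) : R :=
  \int[lebesgue_measure]_(v in prod_range R) (v * dens M g v).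

(* [hired o g v] is the density of type-(g, v) workers hired. *)
Record firm_outcome (R : realType) := FirmOutcome {
  hired : group -> R -> R;
  wage : group -> R -> R
}.

Definition outcome (R : realType) := firm -> firm_outcome R.

(* The infimum and supremum are taken in the extended reals since wages need
   not be bounded. *)
Definition EPSW (R : realType) (o : firm_outcome R) : Prop :=
  ~ exists (g : group) (V V' : set R),
      [/\ [/\ measurable V, V `<=` prod_range R
            & (0 < lebesgue_measure V)%E],
          [/\ measurable V', V' `<=` prod_range R
            & (0 < lebesgue_measure V')%E],
          forall v, V v -> 0 < hired o g v,
          forall v, V' v -> 0 < hired o (other_group g) v
        & (ereal_sup [set (wage o g v)%:E | v in V]
           < ereal_inf [set (wage o (other_group g) v)%:E | v in V'])%E].

(* Here and below the flag [epsw] tells whether the EPSW restriction is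
   imposed. *)
Definition is_firm_outcome (R : realType) (epsw : bool) (M : market R)
    (o : firm_outcome R) : Prop :=
  [/\ forall g, measurable_fun (prod_range R) (hired o g)
             /\ measurable_fun (prod_range R) (wage o g),
      forall g v, prod_range R v ->
        [/\ 0 <= hired o g v, hired o g v <= dens M g v, 0 <= wage o g v
          & hired o g v = 0 -> wage o g v = 0]
    & epsw -> EPSW o].

Definition is_outcome (R : realType) (epsw : bool) (M : market R)
    (O : outcome R) : Prop :=
  (forall i, is_firm_outcome epsw M (O i)) /\
  (forall g v, prod_range R v ->
     hired (O Firm1) g v + hired (O Firm2) g v <= dens M g v).

(* Extended-real valued: the integrands are bounded above, but total wages may
   be infinite, in which case the profit is -oo. *)
Definition profit (R : realType) (M : market R) (o : firm_outcome R) : \bar R :=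
  let surplus g := (\int[lebesgue_measure]_(v in prod_range R)
                      ((v - wage o g v) * hired o g v)%:E)%E in
  ((beta M)%:E * surplus GA + surplus GB)%E.

Definition firm_equiv (R : realType) (o o' : firm_outcome R) : Prop :=
  forall g, for_almost_all (fun v =>
    hired o g v = hired o' g v /\ wage o g v = wage o' g v).

Definition equivalent (R : realType) (O O' : outcome R) : Prop :=
  (forall i, firm_equiv (O i) (O' i)) \/
  (forall i, firm_equiv (O i) (O' (other_firm i))).

Definition blocks (R : realType) (M : market R) (O : outcome R) (j : firm)
    (o : firm_outcome R) : Prop :=
  (profit M (O j) < profit M o)%E /\
  forall g, for_almost_all (fun v =>
    let oj := O j in
    let ok := O (other_firm j) in
    [\/ wage oj g v <= wage o g v /\ wage ok g v < wage o g v,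
        wage oj g v <= wage o g v /\
          hired o g v + hired ok g v <= dens M g v,
        wage ok g v < wage o g v /\
          hired o g v + hired oj g v <= dens M g v
      | hired o g v + hired oj g v + hired ok g v <= dens M g v]).

Definition core (R : realType) (epsw : bool) (M : market R) (O : outcome R) :
    Prop :=
  is_outcome epsw M O /\
  forall j o, is_firm_outcome epsw M o -> ~ blocks M O j o.

Definition full_segregation (R : realType) (M : market R) (O : outcome R) :
    Prop :=
  exists i, for_almost_all (fun v =>
    hired (O i) GA v = dens M GA v /\
    hired (O (other_firm i)) GB v = dens M GB v).

(* Not scaled by the mass of the group: for A there is no factor beta. *)
Definition AW (R : realType) (O : outcome R) (g : group) : \bar R :=
  let paid i := (\int[lebesgue_measure]_(v in prod_range R)
                   (wage (O i) g v * hired (O i) g v)%:E)%E in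
  (paid Firm1 + paid Firm2)%E.

Definition wage_gap (R : realType) (O : outcome R) : \bar R :=
  (AW O GA - AW O GB)%E.

(* The ratio is undefined when AW_A = AW_B = 0; the value 0 used there is
   smaller than the (positive) ratio of the core outcomes without EPSW, so that
   an outcome with a ratio at least that large has a well-defined one. *)
Definition wage_ratio (R : realType) (O : outcome R) : \bar R :=
  if AW O GB != 0%E then (AW O GA / AW O GB)%E
  else if (0 < AW O GA)%E then +oo%E else 0%E.

(* [X] is a statistic of outcomes (the wage gap or the wage ratio) that takes a
   single value on the core without EPSW; [O] yields that value. *)
Definition same_as_core_without_EPSW (R : realType) (M : market R)
    (X : outcome R -> \bar R) (O : outcome R) : Prop :=
  (exists O0, core false M O0) /\
  (forall O0, core false M O0 -> X O = X O0).

(* A core outcome under EPSW, unique up to equivalence, yields the value of [X]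
   of the core without EPSW, and [X] is strictly larger in all the others. *)
Definition unique_core_without_EPSW_level (R : realType) (M : market R)
    (X : outcome R -> \bar R) : Prop :=
  exists O, [/\ core true M O,
    same_as_core_without_EPSW M X O,
    forall O', core true M O' -> same_as_core_without_EPSW M X O' ->
      equivalent O O'
  & forall O', core true M O' -> ~ equivalent O O' -> (X O < X O')%E].

(* Both firms earn the same profit in a core outcome; quantifying over the firm
   in each outcome avoids singling one out. *)
Definition higher_iff_higher_firm_profit (R : realType) (M : market R)
    (X : outcome R -> \bar R) : Prop :=
  forall O O', core true M O -> core true M O' ->
  forall i i', ((X O' < X O) <-> (profit M (O' i') < profit M (O i)))%E.

(* Main.v *)
(* In a core outcome under EPSW with full segregation, each firm may poach
   either whole group at slightly higher wages; hence both firms earn the same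
   profit [p] and no wage exceeds productivity. Group A is then paid
   [E_A - p / beta] and group B [E_B - p] in total, so the wage gap and the wage
   ratio are strictly increasing functions of [p]. At [p = 0] everyone is paid
   their productivity, as in every core outcome without EPSW. Small positive
   profits are sustained by markdowns on A workers of low productivity and on
   B workers of high productivity: exploiting both at once would require a
   higher pay for B workers than for A workers, against EPSW. *)
Require Import Defs.
From HB Require Import structures.
From mathcomp Require Import all_boot all_order all_algebra.
From mathcomp Require Import all_classical all_reals all_analysis.
From mathcomp Require Import measurable_realfun.
From mathcomp Require Import ring lra.

Set Implicit Arguments.
Unset Strict Implicit.
Unset Printing Implicit Defensive.

Import Order.TTheory GRing.Theory Num.Theory.
Import numFieldNormedType.Exports.

Local Open Scope classical_set_scope.
Local Open Scope ring_scope.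

(** * Integrals over the range of productivities *)

Section Integration.
Variable R : realType.
Implicit Types f g h : R -> R.

(** Taking workers from a rival demands a strictly higher wage, so a poaching offer never attains
    the bound that it suggests: each such argument makes a small raise and lets it vanish. Without
    EPSW a firm may alter its offer on any set of types and keep the rest, so the core conditions
    hold type by type and reduce to Bertrand competition for one type. Under EPSW such a patch may
    break the restriction. Offers to a single group comply automatically, so poaching yields only
    comparisons of integrals over a whole group, and pointwise facts have to be recovered from cases
    of equality. Wages may be unbounded, so profits are extended reals; but a firm can always hire
    nobody, which makes core profits nonnegative and the surpluses integrable. Nonnegative pay of
    group B gives [p <= E_B]; at this endpoint the wage ratio is [+oo], below it the ratio is a
    quotient of reals. *)

Definition pint f : \bar R :=
  (\int[lebesgue_measure]_(v in prod_range R) (f v)%:E)%E.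

Lemma measurable_prod_range : measurable (prod_range R).
Proof. exact: measurable_itv. Qed.
#[local] Hint Resolve measurable_prod_range : core.

Lemma prod_range_measure : (@lebesgue_measure R (prod_range R) = 1)%E.
Proof. by rewrite /prod_range lebesgue_measure_itv /= lte_fin ltr01 sube0. Qed.

Lemma prod_rangeP (v : R) : prod_range R v <-> 0 <= v <= 1.
Proof. by rewrite /prod_range /= in_itv. Qed.

Lemma aa_all (P : R -> Prop) :
  (forall v, prod_range R v -> P v) -> for_almost_all P.
Proof. by move=> h; exact: aeW. Qed.

Lemma aa_mono (P Q : R -> Prop) :
  (forall v, prod_range R v -> P v -> Q v) ->
  for_almost_all P -> for_almost_all Q.
Proof.
rewrite /for_almost_all => h.
apply: (@filterS _ _ (ae_filter_ringOfSetsType _)) => v hv Dv.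
exact: h (hv Dv).
Qed.

Lemma aa_mono2 (P Q S : R -> Prop) :
  (forall v, prod_range R v -> P v -> Q v -> S v) ->
  for_almost_all P -> for_almost_all Q -> for_almost_all S.
Proof.
rewrite /for_almost_all => h.
apply: (@filterS2 _ _ (ae_filter_ringOfSetsType _)) => v hv hw Dv.
exact: h (hv Dv) (hw Dv).
Qed.

Lemma aa_forall (P : nat -> R -> Prop) :
  (forall n, for_almost_all (P n)) -> for_almost_all (fun v => forall n, P n v).
Proof.
move=> h; have := @ae_foralln _ _ _ (@lebesgue_measure R)
  (fun n v => prod_range R v -> P n v) h.
by apply: (@filterS _ _ (ae_filter_ringOfSetsType _)) => v hv Dv n; exact: hv.
Qed.

(** A nonempty open interval has positive measure, so it does not fit into the null exceptional
    set. *)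
Lemma aa_itv (a b : R) (P : R -> Prop) : 0 <= a -> a < b -> b <= 1 ->
  for_almost_all P -> exists2 v, a < v < b & P v.
Proof.
move=> a0 ab b1 hP; apply: contrapT => nP.
have : (@lebesgue_measure R).-negligible `]a, b[%classic.
  apply: negligibleS hP => v /=; rewrite in_itv /= => abv hv; apply: nP.
  exists v => //; apply: hv; apply/prod_rangeP.
  by move/andP: abv => [av vb]; apply/andP; split; lra.
move/negligibleP => /(_ (measurable_itv _)) ab0.
have : (@lebesgue_measure R `]a, b[%classic = 0)%E by [].
rewrite lebesgue_measure_itv /= lte_fin ab -EFinB => -[] /eqP.
by rewrite subr_eq0 gt_eqF.
Qed.

(** Integrability is not assumed, since unbounded wages can make an integral [-oo]; positive and
    negative parts are compared separately. *)
Lemma pint_le f g : measurable_fun (prod_range R) f ->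
  measurable_fun (prod_range R) g ->
  for_almost_all (fun v => f v <= g v) -> (pint f <= pint g)%E.
Proof.
move=> mf mg fg; rewrite /pint integralE [leRHS]integralE.
have mf' : measurable_fun (prod_range R) (EFin \o f).
  exact/measurable_EFinP.
have mg' : measurable_fun (prod_range R) (EFin \o g).
  exact/measurable_EFinP.
apply: leeB.
- apply: ae_ge0_le_integral => //; try exact: measurable_funepos.
  move: fg; apply: aa_mono => v _ fgv.
  by rewrite !funeposE -!EFin_max lee_fin ge_max !le_max fgv lexx orbT.
- apply: ae_ge0_le_integral => //; try exact: measurable_funeneg.
  move: fg; apply: aa_mono => v _ fgv.
  rewrite !funenegE -!EFinN -!EFin_max lee_fin ge_max !le_max.
  by rewrite lerN2 fgv lexx orbT.
Qed.

Lemma pint_eq f g : measurable_fun (prod_range R) f ->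
  measurable_fun (prod_range R) g ->
  for_almost_all (fun v => f v = g v) -> pint f = pint g.
Proof.
move=> mf mg fg; apply/eqP; rewrite eq_le; apply/andP; split;
  by apply: pint_le => //; move: fg; apply: aa_mono => v _ ->.
Qed.

Lemma pint_cst (c : R) : pint (cst c) = c%:E.
Proof.
transitivity (c%:E * @lebesgue_measure R (prod_range R))%E.
  exact: (integral_cst (@lebesgue_measure R) measurable_prod_range c%:E).
by rewrite prod_range_measure mule1.
Qed.

Lemma pint_ge0 f : measurable_fun (prod_range R) f ->
  for_almost_all (fun v => 0 <= f v) -> (0 <= pint f)%E.
Proof.
move=> mf f0; apply: (@le_trans _ _ (pint (cst 0))); first by rewrite pint_cst.
exact: pint_le.
Qed.

Definition pintegrable f :=
  (@lebesgue_measure R).-integrable (prod_range R) (EFin \o f).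

(** The positive part is bounded on a range of measure 1, and an infinite negative part would make
    the integral [-oo]. *)
Lemma pintegrable_ub f (C : R) : measurable_fun (prod_range R) f ->
  (forall v, prod_range R v -> f v <= C) -> (-oo < pint f)%E -> pintegrable f.
Proof.
move=> mf fC; rewrite /pint integralE => fNy.
have mf' : measurable_fun (prod_range R) (EFin \o f) by exact/measurable_EFinP.
have pos_fin : (\int[@lebesgue_measure R]_(x in prod_range R)
    ((fun v => (f v)%:E)^\+)%E x < +oo)%E.
  apply: (@le_lt_trans _ _ (pint (cst (Num.max C 0))));
    last by rewrite pint_cst ltry.
  apply: ge0_le_integral => //; try exact: measurable_funepos.
  - exact/measurable_EFinP.
  - move=> v Dv; rewrite funeposE -EFin_max lee_fin /=.
    by rewrite ge_max !le_max lexx orbT fC.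
have neg_fin : (\int[@lebesgue_measure R]_(x in prod_range R)
    ((fun v => (f v)%:E)^\-)%E x < +oo)%E.
  rewrite ltey; apply/eqP => neg; move: fNy; rewrite neg.
  by rewrite /= addeNy ?ltxx// -ltey.
apply/integrableP; split=> //.
rewrite (_ : (fun x => `|(EFin \o f) x|%E) =
  (fun x => (EFin \o f)^\+ x + (EFin \o f)^\- x)%E); last first.
  by apply/funext => x; rewrite -[LHS]/((abse \o (EFin \o f)) x) fune_abse.
rewrite ge0_integralD//; first exact: lte_add_pinfty.
- exact: measurable_funepos.
- exact: measurable_funeneg.
Qed.

Lemma pintegrable_bounded f (C : R) : measurable_fun (prod_range R) f ->
  (forall v, prod_range R v -> 0 <= f v <= C) -> pintegrable f.
Proof.
move=> mf fC; apply: (@pintegrable_ub _ C) => //.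
  by move=> v /fC/andP[].
apply: (@lt_le_trans _ _ 0%E) => //.
by apply: pint_ge0 => //; apply: aa_all => v /fC/andP[].
Qed.

Lemma pintB f g : pintegrable f -> pintegrable g ->
  pint (f \- g) = (pint f - pint g)%E.
Proof. by move=> fi gi; rewrite /pint -integralB_EFin. Qed.

Lemma pintZ (k : R) f : pintegrable f ->
  pint (fun v => k * f v) = (k%:E * pint f)%E.
Proof. by move=> fi; rewrite /pint -integralZl. Qed.

Lemma pintegrable_measurable f :
  pintegrable f -> measurable_fun (prod_range R) f.
Proof. by move/integrableP => [/measurable_EFinP]. Qed.

Lemma pintegrable_fin f : pintegrable f -> (pint f \is a fin_num)%E.
Proof. by move=> fi; exact: integrable_fin_num. Qed.

(** The nonnegative difference has integral 0. This is how comparisons of total profits are turned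
    into statements about almost every type. *)
Lemma pint_le_eq f g : pintegrable f -> pintegrable g ->
  (forall v, prod_range R v -> f v <= g v) -> (pint g <= pint f)%E ->
  for_almost_all (fun v => f v = g v).
Proof.
move=> fi gi fg gf.
have mf := pintegrable_measurable fi.
have mg := pintegrable_measurable gi.
have : pint (g \- f) = 0%E.
  have -> : pint (g \- f) = (pint g - pint f)%E by exact: pintB.
  have -> : pint f = pint g.
    by apply/eqP; rewrite eq_le gf andbT; apply: pint_le => //; exact: aa_all.
  by rewrite subee// pintegrable_fin.
rewrite /pint => int0.
have mgf : measurable_fun (prod_range R) (EFin \o (g \- f)).
  by apply/measurable_EFinP; exact: measurable_funB.
have : (\int[@lebesgue_measure R]_(x in prod_range R) `|((g \- f) x)%:E| = 0)%E.
  rewrite -int0; apply: eq_integral => v /set_mem Dv.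
  by rewrite gee0_abs// lee_fin subr_ge0 fg.
move/(ae_eq_integral_abs (@lebesgue_measure R) measurable_prod_range mgf).1.
by apply: aa_mono => v _ /= -[] /eqP; rewrite subr_eq0 => /eqP.
Qed.

Lemma pint_gt0 f (a b C : R) : measurable_fun (prod_range R) f ->
  (forall v, prod_range R v -> 0 <= f v <= C) ->
  0 <= a -> a < b -> b <= 1 -> (forall v, a < v < b -> 0 < f v) ->
  exists2 K : R, 0 < K & pint f = K%:E.
Proof.
move=> mf fC a0 ab b1 f0.
have fi := pintegrable_bounded mf fC.
exists (fine (pint f)); last by rewrite fineK// pintegrable_fin.
have f_ge0 : (0 <= pint f)%E.
  by apply: pint_ge0 => //; apply: aa_all => v /fC/andP[].
rewrite fine_gt0// lt0e f_ge0 andbT ltey_eq pintegrable_fin// andbT.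
apply/eqP => f_eq0.
have i0 : pintegrable (cst 0).
  by apply: (@pintegrable_bounded _ 0) => // v _; rewrite lexx.
have fD v : prod_range R v -> cst 0 v <= f v by move=> /fC/andP[].
have := pint_le_eq i0 fi fD; rewrite f_eq0 pint_cst => /(_ (lexx _)).
case/(aa_itv a0 ab b1) => v abv /= fv0.
by have := f0 v abv; rewrite -fv0 ltxx.
Qed.

End Integration.

(** * Deviations from core outcomes *)

Lemma measurable_if (R : realType) (c : R -> bool) (f g : R -> R) :
  measurable_fun (prod_range R) c ->
  measurable_fun (prod_range R) f -> measurable_fun (prod_range R) g ->
  measurable_fun (prod_range R) (fun v => if c v then f v else g v).
Proof.
move=> mc mf mg; apply: measurable_fun_if => //; first exact: measurable_itv.
- by apply: measurable_funS mf => //; exact: measurable_itv.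
- by apply: measurable_funS mg => //; exact: measurable_itv.
Qed.

Section Market.
Variables (R : realType) (M : market R).
Implicit Types (O : outcome R) (o : firm_outcome R) (g : group) (i j k : firm).

Lemma dens_gt0 g (v : R) : prod_range R v -> 0 < dens M g v.
Proof.
move=> Dv; rewrite -lte_fin; apply: lt_le_trans (dens_inf_gt0 M g) _.
by apply: ereal_inf_lbound; exists v.
Qed.

Lemma dens_le g : exists C : R, forall v, prod_range R v -> dens M g v <= C.
Proof.
exists (fine (ereal_sup [set (dens M g v)%:E | v in prod_range R])) => v Dv.
have sup_ge : ((dens M g v)%:E <=
    ereal_sup [set (dens M g v)%:E | v in prod_range R])%E.
  by apply: ereal_sup_ubound; exists v.
rewrite -lee_fin fineK// fin_numE; apply/andP; split.
- by apply/eqP => supNy; move: sup_ge; rewrite supNy.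
- by rewrite -ltey dens_sup_lty.
Qed.

Lemma measurable_idv : measurable_fun (prod_range R) (fun v : R => v).
Proof. exact: measurable_id. Qed.

Let mdens g : measurable_fun (prod_range R) (dens M g).
Proof. exact: dens_measurable. Qed.

Lemma measurable_mul_dens (f : R -> R) g : measurable_fun (prod_range R) f ->
  measurable_fun (prod_range R) (fun v => f v * dens M g v).
Proof. by move=> mf; exact: measurable_funM. Qed.

Lemma pintegrable_mul_dens (f : R -> R) g : measurable_fun (prod_range R) f ->
  (forall v, prod_range R v -> 0 <= f v <= 1) ->
  pintegrable (fun v => f v * dens M g v).
Proof.
move=> mf f01; have [C dC] := dens_le g.
apply: (@pintegrable_bounded _ _ C); first exact: measurable_mul_dens.
move=> v Dv; have d0 := dens_gt0 g Dv; have dCv := dC v Dv.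
by have /andP[f0 f1] := f01 v Dv; apply/andP; split; nra.
Qed.

Lemma pint_mul_dens_gt0 (f : R -> R) (a b : R) g :
  measurable_fun (prod_range R) f ->
  (forall v, prod_range R v -> 0 <= f v <= 1) ->
  0 <= a -> a < b -> b <= 1 -> (forall v, a < v < b -> 0 < f v) ->
  exists2 K : R, 0 < K & pint (fun v => f v * dens M g v) = K%:E.
Proof.
move=> mf f01 a0 ab b1 f0; have [C dC] := dens_le g.
apply: (@pint_gt0 _ _ a b C) => //; first exact: measurable_mul_dens.
- move=> v Dv; have d0 := dens_gt0 g Dv; have dCv := dC v Dv.
  by have /andP[f0v f1v] := f01 v Dv; apply/andP; split; nra.
- move=> v abv; rewrite mulr_gt0 ?f0// dens_gt0//; apply/prod_rangeP.
  by case/andP: abv => av vb; apply/andP; split; lra.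
Qed.

Lemma pintegrable_vdens g : pintegrable (fun v => v * dens M g v).
Proof.
apply: pintegrable_mul_dens => [|v /prod_rangeP//]; exact: measurable_idv.
Qed.

Lemma pint_vdens g : pint (fun v => v * dens M g v) = (mean_prod M g)%:E.
Proof.
rewrite /mean_prod /Rintegral fineK//.
exact: (pintegrable_fin (pintegrable_vdens g)).
Qed.

Definition mass g : R := if g is GA then beta M else 1.

Lemma mass_gt0 g : 0 < mass g.
Proof. by case: g => //=; exact: lt_le_trans ltr01 (beta_ge1 M). Qed.

Definition surplus o g (v : R) : R := (v - wage o g v) * hired o g v.

Lemma profitE o : profit M o =
  ((mass GA)%:E * pint (surplus o GA) + (mass GB)%:E * pint (surplus o GB))%E.
Proof. by rewrite /= mul1e. Qed.

(** Imposes the convention of wage 0 where nobody is hired, which does not affect the surplus. *)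
Definition trim (h w : group -> R -> R) : firm_outcome R :=
  FirmOutcome h (fun g v => if h g v == 0 then 0 else w g v).

Lemma surplus_trim h w g v : surplus (trim h w) g v = (v - w g v) * h g v.
Proof. by rewrite /surplus /=; case: eqP => // ->; rewrite !mulr0. Qed.

Lemma EPSW_single o g :
  (forall v, prod_range R v -> hired o (other_group g) v <= 0) -> EPSW o.
Proof.
move=> h0 [g' [V [V' [[_ VD V0] [_ V'D V'0] hV hV' _]]]].
have pos_ex (U : set R) : (0 < @lebesgue_measure R U)%E -> U !=set0.
  move=> U0; apply/set0P/eqP => U_eq0.
  by move: U0; rewrite U_eq0 measure0 ltxx.
have [v Vv] := pos_ex _ V0; have [u V'u] := pos_ex _ V'0.
have := hV v Vv; have := hV' u V'u.
by move: h0; case: g; case: g' {hV hV'} => /= h0; rewrite !ltNge !h0 //; auto.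
Qed.

Lemma trim_is_firm_outcome (b : bool) (h w : group -> R -> R) :
  (forall g, measurable_fun (prod_range R) (h g)) ->
  (forall g, measurable_fun (prod_range R) (w g)) ->
  (forall g v, prod_range R v -> 0 <= h g v <= dens M g v) ->
  (forall g v, prod_range R v -> 0 <= w g v) ->
  (b -> EPSW (trim h w)) -> is_firm_outcome b M (trim h w).
Proof.
move=> mh mw h01 w0 E; split=> // [g|g v Dv].
- split; first exact: mh.
  apply: measurable_if => //; exact: (measurable_fun_eqr (mh g)).
- have /andP[-> ->] := h01 g v Dv; split=> //=; last by move=> ->; rewrite eqxx.
  by case: ifP => // _; exact: w0.
Qed.

Lemma measurable_surplus b o g : is_firm_outcome b M o ->
  measurable_fun (prod_range R) (surplus o g).
Proof.
move=> [mo _ _]; apply: measurable_funM; last exact: (mo g).1.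
apply: measurable_funB; [exact: measurable_idv|exact: (mo g).2].
Qed.

Lemma surplus_ub b o g : is_firm_outcome b M o ->
  exists C : R, forall v, prod_range R v -> surplus o g v <= C.
Proof.
move=> [_ ho _]; have [C dC] := dens_le g; exists C => v Dv.
have [h0 hd w0 _] := ho g v Dv; have dCv := dC v Dv.
by have /prod_rangeP/andP[v0 v1] := Dv; rewrite /surplus; nra.
Qed.

Lemma pint_surplus_ltey b o g : is_firm_outcome b M o ->
  (pint (surplus o g) < +oo)%E.
Proof.
move=> fo; have [C sC] := surplus_ub g fo.
apply: (@le_lt_trans _ _ (pint (cst C))); last by rewrite pint_cst ltry.
apply: pint_le => //; first exact: measurable_surplus fo.
exact: aa_all.
Qed.

(** Neither group can contribute [+oo], so a contribution [-oo] from one group would make the whole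
    profit [-oo]. *)
Lemma pintegrable_surplus b o : is_firm_outcome b M o ->
  (-oo < profit M o)%E -> forall g, pintegrable (surplus o g).
Proof.
move=> fo p0 g; have [C sC] := surplus_ub g fo.
apply: (pintegrable_ub _ sC); first exact: measurable_surplus fo.
have ltA := pint_surplus_ltey GA fo; have ltB := pint_surplus_ltey GB fo.
rewrite ltNye; apply/eqP => sNy; move: p0; rewrite profitE.
by case: g {C sC} sNy => ->; rewrite gt0_muleNy ?lte_fin ?mass_gt0//;
  rewrite ?addeNy ?addNye ?ltxx.
Qed.

Lemma profit_single b o g : is_firm_outcome b M o ->
  for_almost_all (fun v => hired o (other_group g) v = 0) ->
  profit M o = ((mass g)%:E * pint (surplus o g))%E.
Proof.
move=> fo h0; rewrite profitE.
have : pint (surplus o (other_group g)) = 0%E.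
  rewrite -[RHS]/(0%:E) -(pint_cst 0); apply: pint_eq => //.
    exact: measurable_surplus fo.
  by move: h0; apply: aa_mono => v _; rewrite /surplus => ->; rewrite mulr0.
by case: g {h0} => /= ->; rewrite mule0 ?adde0 ?add0e.
Qed.

Lemma profit_ae b o o' : is_firm_outcome b M o -> is_firm_outcome b M o' ->
  firm_equiv o o' -> profit M o = profit M o'.
Proof.
move=> fo fo' oo'; rewrite !profitE.
have surplusE g : pint (surplus o g) = pint (surplus o' g).
  apply: pint_eq; [exact: measurable_surplus fo|exact: measurable_surplus fo'|].
  by move: (oo' g); apply: aa_mono => v _ []; rewrite /surplus => -> ->.
by rewrite !surplusE.
Qed.

Definition can_hire O j g (v h w : R) : Prop :=
  let oj := O j in
  let ok := O (other_firm j) in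
  [\/ wage oj g v <= w /\ wage ok g v < w,
      wage oj g v <= w /\ h + hired ok g v <= dens M g v,
      wage ok g v < w /\ h + hired oj g v <= dens M g v
    | h + hired oj g v + hired ok g v <= dens M g v].

Lemma hiredD_le b O j g v : is_outcome b M O -> prod_range R v ->
  hired (O j) g v + hired (O (other_firm j)) g v <= dens M g v.
Proof.
by move=> [_ /(_ g v)] h /h; case: j => //=; rewrite addrC.
Qed.

(** Where the deviation hires nobody, the fourth blocking condition is just feasibility of [O];
    offers need checking only where [h] is positive. *)
Lemma core_deviation (b : bool) O j (h w : group -> R -> R) : core b M O ->
  (forall g, measurable_fun (prod_range R) (h g)) ->
  (forall g, measurable_fun (prod_range R) (w g)) ->
  (forall g v, prod_range R v -> 0 <= h g v <= dens M g v) ->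
  (forall g v, prod_range R v -> 0 <= w g v) ->
  (b -> EPSW (trim h w)) ->
  (forall g, for_almost_all (fun v =>
     0 < h g v -> can_hire O j g v (h g v) (w g v))) ->
  (profit M (trim h w) <= profit M (O j))%E.
Proof.
move=> [oO cO] mh mw h01 w0 E hw; rewrite leNgt; apply/negP => lt.
apply: (cO j (trim h w)); first exact: trim_is_firm_outcome.
split=> // g; move: (hw g); apply: aa_mono => v Dv.
have /andP[] := h01 g v Dv; rewrite le_eqVlt => /predU1P[h0 _ _|h0 _ /(_ h0)].
- by constructor 4; rewrite /= -h0 add0r (hiredD_le _ _ oO).
- by rewrite /can_hire /= gt_eqF.
Qed.

(** Hiring nobody is always an admissible deviation, with profit 0. *)
Lemma core_profit_ge0 b O j : core b M O -> (0 <= profit M (O j))%E.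
Proof.
move=> cO; have -> : 0%E = profit M (trim (fun _ _ => 0) (fun _ _ => 0)).
  rewrite profitE.
  have -> g : pint (surplus (trim (fun _ _ => 0) (fun _ _ => 0)) g) = 0%E.
    rewrite -[RHS]/(0%:E) -(pint_cst 0); congr pint.
    by apply/funext => v; rewrite surplus_trim mulr0.
  by rewrite !mule0 adde0.
apply: core_deviation cO _ _ _ _ _ _ => //.
- by move=> g v Dv; rewrite lexx ltW// dens_gt0.
- by move=> _; apply: (@EPSW_single _ GA).
- by move=> g; apply: aa_all => v _; rewrite ltxx.
Qed.

Lemma core_pintegrable b O j g : core b M O -> pintegrable (surplus (O j) g).
Proof.
move=> cO; apply: (pintegrable_surplus (cO.1.1 j)).
exact: lt_le_trans (core_profit_ge0 j cO).
Qed.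

End Market.

(** * The core without EPSW *)

Section CoreWithoutEPSW.
Variables (R : realType) (M : market R).
Implicit Types (O : outcome R) (o : firm_outcome R) (g : group) (i j k : firm).

Definition same_group g g' : bool :=
  match g, g' with GA, GA | GB, GB => true | _, _ => false end.

Lemma same_groupP g g' : reflect (g = g') (same_group g g').
Proof. by case: g; case: g'; constructor. Qed.

Lemma surplus_le_of_profit o o' g :
  (forall g', pintegrable (surplus o g')) ->
  (forall g', pintegrable (surplus o' g')) ->
  (profit M o' <= profit M o)%E ->
  (pint (surplus o (other_group g)) <= pint (surplus o' (other_group g)))%E ->
  (pint (surplus o' g) <= pint (surplus o g))%E.
Proof.
move=> io io'; rewrite !profitE; case: g; rewrite [other_group _]/=;
have := mass_gt0 M GA; have := mass_gt0 M GB;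
rewrite -(fineK (pintegrable_fin (io GA))) -(fineK (pintegrable_fin (io GB)));
rewrite -(fineK (pintegrable_fin (io' GA))) -(fineK (pintegrable_fin (io' GB)));
by rewrite -!EFinM -!EFinD !lee_fin => *; nra.
Qed.

(* Deviating from the core outcome only where that is profitable, and only in
   group [g], shows that no admissible offer is better on a non-null set. *)
Lemma core_pointwise O j g (h w : R -> R) : core false M O ->
  measurable_fun (prod_range R) h -> measurable_fun (prod_range R) w ->
  (forall v, prod_range R v -> [/\ 0 <= h v <= dens M g v, 0 <= w v
     & 0 < h v -> can_hire M O j g v (h v) (w v)]) ->
  for_almost_all (fun v => (v - w v) * h v <= surplus (O j) g v).
Proof.
move=> cO mh mw hw.
have fO := cO.1.1 j; have [mO hO _] := fO.
pose better v := surplus (O j) g v < (v - w v) * h v.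
have mbetter : measurable_fun (prod_range R) better.
  apply: measurable_fun_ltr; first exact: (measurable_surplus g fO).
  by apply: measurable_funM => //; exact: measurable_funB.
pose H g' v := if same_group g g' && better v then h v else hired (O j) g' v.
pose W g' v := if same_group g g' && better v then w v else wage (O j) g' v.
have H01 g' v : prod_range R v -> 0 <= H g' v <= dens M g' v.
  move=> Dv; rewrite /H; case: ifP => [/andP[/same_groupP <- _]|_].
    by case: (hw v Dv).
  by have [-> ->] := hO g' v Dv.
have W0 g' v : prod_range R v -> 0 <= W g' v.
  move=> Dv; rewrite /W; case: ifP => [_|_]; first by case: (hw v Dv).
  by have [] := hO g' v Dv.
have mH g' : measurable_fun (prod_range R) (H g').
  apply: measurable_if => //; last exact: (mO g').1.
  by case: same_group.
have mW g' : measurable_fun (prod_range R) (W g').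
  apply: measurable_if => //; last exact: (mO g').2.
  by case: same_group.
have fHW : is_firm_outcome false M (trim H W) by exact: trim_is_firm_outcome.
have le_profit : (profit M (trim H W) <= profit M (O j))%E.
  apply: (core_deviation cO mH mW H01 W0) => // g'.
  apply: aa_all => v Dv; rewrite /H /W.
  case: ifP => [/andP[/same_groupP <- _]|_ _]; first by case: (hw v Dv).
  by constructor 2; split=> //; exact: (hiredD_le _ _ cO.1).
have surplusE g' v : surplus (trim H W) g' v =
    if same_group g g' && better v then (v - w v) * h v
    else surplus (O j) g' v.
  by rewrite surplus_trim /H /W; case: ifP.
have surplus_ge g' v : surplus (O j) g' v <= surplus (trim H W) g' v.
  rewrite surplusE; case: ifP => // /andP[/same_groupP <-]; exact: ltW.
have iO g' : pintegrable (surplus (O j) g') by exact: core_pintegrable cO.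
(* The patched outcome earns at least as much on every type, so its profit is not [-oo]. *)
have iHW g' : pintegrable (surplus (trim H W) g').
  apply: (pintegrable_surplus fHW).
  apply: lt_le_trans (_ : (-oo < 0)%E) _ => //.
  apply: le_trans (core_profit_ge0 j cO) _; rewrite !profitE leeD//.
  - rewrite lee_pmul2l ?lte_fin ?mass_gt0//.
    apply: pint_le; [exact: pintegrable_measurable (iO _)|
      exact: measurable_surplus fHW|exact: aa_all].
  - rewrite lee_pmul2l ?lte_fin ?mass_gt0//.
    apply: pint_le; [exact: pintegrable_measurable (iO _)|
      exact: measurable_surplus fHW|exact: aa_all].
have le_other : (pint (surplus (O j) (other_group g)) <=
    pint (surplus (trim H W) (other_group g)))%E.
  apply: pint_le; [exact: pintegrable_measurable (iO _)|
    exact: measurable_surplus fHW|exact: aa_all].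
have : (pint (surplus (trim H W) g) <= pint (surplus (O j) g))%E.
  exact: surplus_le_of_profit le_profit le_other.
move/(pint_le_eq (iO g) (iHW g) (fun v _ => surplus_ge g v)).
apply: aa_mono => v _ eq_sur; rewrite leNgt; apply/negP => lt.
have := surplusE g v; rewrite /better lt andbC /= -eq_sur.
rewrite (_ : same_group g g); last exact/same_groupP.
by move=> eq; move: lt; rewrite -eq ltxx.
Qed.

Lemma le_of_le_invn (x y c : R) :
  (forall n, x - c / n.+1%:R <= y) -> x <= y.
Proof.
move=> h; rewrite leNgt; apply/negP => yx.
have [c0|c0] := leP c 0.
  have := h 0%N; rewrite divr1; lra.
pose n := Num.truncn (c / (x - y)).
have := truncnS_gt (c / (x - y)); rewrite -/n ltr_pdivrMr ?subr_gt0// => cn.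
have := h n; have n0 : 0 < n.+1%:R :> R by rewrite ltr0n.
have : c / n.+1%:R < x - y by rewrite ltr_pdivrMr// mulrC.
by move: (c / _) => q; lra.
Qed.

(** The four bounds come from four offers for a type: hire nobody; hire the unemployed at wage 0;
    swap the own workers for all others just above the rival's wage; hire everybody just above both
    wages. The raises [1 / n.+1] form a countable family, so the exceptional null sets can be united
    before passing to the limit. *)
Lemma core_poach O j g : core false M O ->
  for_almost_all (fun v =>
    [/\ 0 <= surplus (O j) g v,
        v * (dens M g v - hired (O j) g v - hired (O (other_firm j)) g v)
          <= surplus (O j) g v,
        (v - wage (O (other_firm j)) g v) * (dens M g v - hired (O j) g v)
          <= surplus (O j) g v
      & (v - Num.max (wage (O j) g v) (wage (O (other_firm j)) g v))
          * dens M g v <= surplus (O j) g v]).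
Proof.
move=> cO; have md := dens_measurable M g.
have [mj hj _] := cO.1.1 j; have [mk hk _] := cO.1.1 (other_firm j).
have [mhj mwj] := mj g; have [mhk mwk] := mk g.
have h0 := @core_pointwise O j g (cst 0) (cst 0) cO.
have h1 := @core_pointwise O j g
  (fun v => dens M g v - hired (O j) g v - hired (O (other_firm j)) g v)
  (cst 0) cO.
have h2 n := @core_pointwise O j g
  (fun v => dens M g v - hired (O j) g v)
  (fun v => wage (O (other_firm j)) g v + 1 / n.+1%:R) cO.
have h3 n := @core_pointwise O j g (dens M g)
  (fun v => Num.max (wage (O j) g v) (wage (O (other_firm j)) g v)
            + 1 / n.+1%:R) cO.
have n0 n : 0 < 1 / n.+1%:R :> R by rewrite divr_gt0// ltr0n.
have {}h0 : for_almost_all (fun v => 0 <= surplus (O j) g v).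
  apply: aa_mono (h0 _ _ _) => [v _| | |v Dv] //; first by rewrite /= mulr0.
  by split; rewrite /= ?lexx ?ltxx// ltW// dens_gt0.
have {}h1 : for_almost_all (fun v =>
    v * (dens M g v - hired (O j) g v - hired (O (other_firm j)) g v)
      <= surplus (O j) g v).
  apply: aa_mono (h1 _ _ _) => [v _| | |v Dv] //; first by rewrite /= subr0.
    by do 2![apply: measurable_funB => //].
  have := hiredD_le j g cO.1 Dv.
  have [a0 a1 a2 _] := hj g v Dv; have [b0 b1 b2 _] := hk g v Dv => hD.
  split=> //=; first by apply/andP; split; lra.
  by move=> _; constructor 4; lra.
have {}h2 : for_almost_all (fun v =>
    (v - wage (O (other_firm j)) g v) * (dens M g v - hired (O j) g v)
      <= surplus (O j) g v).
  have {}h2 := aa_forall (fun n => h2 n (measurable_funB md mhj)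
    (measurable_funD mwk (measurable_cst _)) _).
  apply: aa_mono (h2 _) => [v _ hn|n v Dv].
    apply: (@le_of_le_invn _ _ (dens M g v - hired (O j) g v)) => n.
    by apply: le_trans (hn n); move: (n.+1%:R^-1) => e; lra.
  have [a0 a1 a2 _] := hj g v Dv; have [b0 b1 b2 _] := hk g v Dv.
  have := n0 n; move: (1 / _) => e e0.
  split; [by apply/andP; split; lra|by lra|].
  by move=> _; constructor 3; split; lra.
have {}h3 : for_almost_all (fun v =>
    (v - Num.max (wage (O j) g v) (wage (O (other_firm j)) g v))
          * dens M g v <= surplus (O j) g v).
  have {}h3 := aa_forall (fun n => h3 n md
    (measurable_funD (measurable_maxr mwj mwk) (measurable_cst _)) _).
  apply: aa_mono (h3 _) => [v _ hn|n v Dv].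
    apply: (@le_of_le_invn _ _ (dens M g v)) => n.
    by apply: le_trans (hn n); move: (n.+1%:R^-1) => e; lra.
  have d0 := dens_gt0 M g Dv; have [_ _ a2 _] := hj g v Dv.
  split; first by rewrite lexx ltW.
    by rewrite addr_ge0 ?(ltW (n0 n))// le_max a2.
  move=> _; constructor 1; split.
    by apply: ler_wpDr; [exact: ltW|rewrite le_max lexx].
  by apply: ltr_pwDr => //; rewrite le_max lexx orbT.
have h01 := aa_mono2 (fun v _ p q => conj p q) h0 h1.
have h23 := aa_mono2 (fun v _ p q => conj p q) h2 h3.
by apply: aa_mono2 h01 h23 => v _ [? ?] [? ?]; split.
Qed.

End CoreWithoutEPSW.

(** * Bertrand competition for one type, and total wages without EPSW *)

Section CoreWithoutEPSWWages.
Variables (R : realType) (M : market R).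
Implicit Types (O : outcome R) (o : firm_outcome R) (g : group) (i j k : firm).

(** Each firm could swap its workers for the rival's at the rival's wage, so the two surpluses
    agree. Once they are known to vanish, hiring unemployed workers at wage 0 would be profitable as
    [v > 0]; hence nobody is unemployed and the whole output is paid out. *)
Lemma bertrand (v d h1 h2 w1 w2 : R) :
  0 < v -> 0 <= h1 -> 0 <= h2 -> h1 + h2 <= d -> 0 < d ->
  0 <= w1 -> 0 <= w2 ->
  (h1 = 0 -> w1 = 0) -> (h2 = 0 -> w2 = 0) ->
  0 <= (v - w1) * h1 -> 0 <= (v - w2) * h2 ->
  v * (d - h1 - h2) <= (v - w1) * h1 ->
  (v - w2) * (d - h1) <= (v - w1) * h1 ->
  (v - w1) * (d - h2) <= (v - w2) * h2 ->
  (v - Num.max w1 w2) * d <= (v - w1) * h1 ->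
  (v - Num.max w1 w2) * d <= (v - w2) * h2 ->
  w1 * h1 + w2 * h2 = v * d.
Proof.
move=> v0 h10 h20 hd d0 w10 w20 hw1 hw2 u1 u2 all1 p1 p2 m1 m2.
have w1v : w1 <= v.
  move: h10; rewrite le_eqVlt => /predU1P[/esym/hw1 ->|h1p]; first exact: ltW.
  by move: u1; rewrite pmulr_lge0// subr_ge0.
have w2v : w2 <= v.
  move: h20; rewrite le_eqVlt => /predU1P[/esym/hw2 ->|h2p]; first exact: ltW.
  by move: u2; rewrite pmulr_lge0// subr_ge0.
have le21 : (v - w2) * h2 <= (v - w1) * h1.
  by apply: le_trans p1; apply: ler_wpM2l; lra.
have le12 : (v - w1) * h1 <= (v - w2) * h2.
  by apply: le_trans p2; apply: ler_wpM2l; lra.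
have u12 : (v - w1) * h1 = (v - w2) * h2 by apply/eqP; rewrite eq_le le12.
(* The firm paying the higher wage [w] earns [(v - w) * d] or more only if it
   hires the whole type or if [w = v]; either way some firm earns nothing. *)
have u0 : (v - w1) * h1 = 0.
  have [w21|w12] := leP w2 w1.
  - move: m1; rewrite (max_idPl w21) => m1.
    have [->|w1v'] := eqVneq w1 v; first by rewrite subrr mul0r.
    have vw1 : 0 < v - w1 by rewrite subr_gt0 lt_neqAle w1v'.
    have : d <= h1 by move: m1; rewrite ler_pM2l.
    by move=> dh; rewrite u12 (_ : h2 = 0) ?mulr0//; lra.
  - move: m2; rewrite (max_idPr (ltW w12)) => m2.
    rewrite u12; have [->|w2v'] := eqVneq w2 v; first by rewrite subrr mul0r.
    have vw2 : 0 < v - w2 by rewrite subr_gt0 lt_neqAle w2v'.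
    have : d <= h2 by move: m2; rewrite ler_pM2l.
    by move=> dh; rewrite -u12 (_ : h1 = 0) ?mulr0//; lra.
have full : h1 + h2 = d.
  apply/eqP; rewrite eq_le hd /=; move: all1; rewrite u0 pmulr_rle0//; lra.
by rewrite -full; lra.
Qed.

Lemma core_without_EPSW_wages O g : core false M O ->
  for_almost_all (fun v =>
    wage (O Firm1) g v * hired (O Firm1) g v
    + wage (O Firm2) g v * hired (O Firm2) g v = v * dens M g v).
Proof.
move=> cO; have [_ h1 _] := cO.1.1 Firm1; have [_ h2 _] := cO.1.1 Firm2.
apply: aa_mono2 (core_poach Firm1 g cO) (core_poach Firm2 g cO) => v Dv.
rewrite /surplus /= => -[u1 a1 p1 m1] [u2 _ p2 m2].
have [a0 b0 c0 e0] := h1 g v Dv; have [a0' b0' c0' e0'] := h2 g v Dv.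
have d0 := dens_gt0 M g Dv.
(* At [v = 0] unemployment cannot be excluded, but nonnegative surpluses already force the wage bill
   to be 0. *)
have /prod_rangeP/andP[] := Dv; rewrite le_eqVlt => /predU1P[v0 _|v0 _].
  by move: u1 u2 (mulr_ge0 c0 a0) (mulr_ge0 c0' a0'); rewrite -v0; lra.
by apply: bertrand => //; [exact: cO.1.2|rewrite maxC].
Qed.

Lemma AW_paid b O g : is_outcome b M O -> AW O g =
  pint (fun v => wage (O Firm1) g v * hired (O Firm1) g v
                 + wage (O Firm2) g v * hired (O Firm2) g v).
Proof.
move=> [fO _]; have [m1 h1 _] := fO Firm1; have [m2 h2 _] := fO Firm2.
have [m11 m12] := m1 g; have [m21 m22] := m2 g.
have mD := @measurable_prod_range R.
rewrite /AW /pint -(ge0_integralD (@lebesgue_measure R) mD)//.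
- by move=> v Dv; have [? _ ? _] := h1 g v Dv; rewrite lee_fin mulr_ge0.
- exact/measurable_EFinP/measurable_funM.
- by move=> v Dv; have [? _ ? _] := h2 g v Dv; rewrite lee_fin mulr_ge0.
- exact/measurable_EFinP/measurable_funM.
Qed.

Lemma measurable_paid b O g : is_outcome b M O ->
  measurable_fun (prod_range R)
    (fun v => wage (O Firm1) g v * hired (O Firm1) g v
                 + wage (O Firm2) g v * hired (O Firm2) g v).
Proof.
move=> [fO _]; have [m1 _ _] := fO Firm1; have [m2 _ _] := fO Firm2.
have [m11 m12] := m1 g; have [m21 m22] := m2 g.
by apply: measurable_funD; exact: measurable_funM.
Qed.

Lemma core_without_EPSW_AW O g : core false M O -> AW O g = (mean_prod M g)%:E.
Proof.
move=> cO; rewrite (AW_paid g cO.1) -pint_vdens; apply: pint_eq.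
- exact: measurable_paid cO.1.
- exact: pintegrable_measurable (pintegrable_vdens M g).
- exact: core_without_EPSW_wages.
Qed.

End CoreWithoutEPSWWages.

(** * Fully segregated core outcomes under EPSW *)

Section SegregatedCore.
Variables (R : realType) (M : market R) (O : outcome R) (i : firm).
Hypothesis cO : core true M O.
Hypothesis sO : for_almost_all (fun v =>
    hired (O i) GA v = dens M GA v /\
    hired (O (other_firm i)) GB v = dens M GB v).
Implicit Types (g : group) (k : firm).

Definition employer g := if g is GA then i else other_firm i.
Definition pay g := wage (O (employer g)) g.

Lemma other_firmK : involutive other_firm. Proof. by case. Qed.

Lemma firm_cases k k' : k = k' \/ k = other_firm k'.
Proof. by case: k; case: k'; auto. Qed.

Lemma employer_ex k : exists g, k = employer g.
Proof.
by case: k; rewrite /employer; case: i;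
  [exists GA|exists GB|exists GB|exists GA].
Qed.

Lemma employer_other g : employer (other_group g) = other_firm (employer g).
Proof. by case: g => //=; rewrite other_firmK. Qed.

Lemma employed g : for_almost_all (fun v =>
  [/\ hired (O (employer g)) g v = dens M g v,
      hired (O (other_firm (employer g))) g v = 0
    & wage (O (other_firm (employer g))) g v = 0]).
Proof.
apply: aa_mono sO => v Dv [hA hB].
have hg : hired (O (employer g)) g v = dens M g v by case: g.
have := hiredD_le (employer g) g cO.1 Dv.
have [_ h _] := cO.1.1 (other_firm (employer g)).
have [h0 _ _ w0] := h g v Dv; rewrite hg => hle.
have hz : hired (O (other_firm (employer g))) g v = 0 by lra.
by split=> //; exact: w0.
Qed.

Let mpay g : measurable_fun (prod_range R) (pay g).
Proof. by have [/(_ g)[]] := cO.1.1 (employer g). Qed.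

Lemma pay_ge0 g v : prod_range R v -> 0 <= pay g v.
Proof. by move=> Dv; have [_ /(_ g v Dv)[]] := cO.1.1 (employer g). Qed.

Definition margin g (v : R) := (v - pay g v) * dens M g v.

(** Almost everywhere this is the surplus of the employer, which is integrable in the core. *)
Lemma margin_integrable g : pintegrable (margin g).
Proof.
have fO := cO.1.1 (employer g); have [C dC] := dens_le M g.
have md : measurable_fun (prod_range R) (margin g).
  by apply: measurable_mul_dens; exact: measurable_funB.
apply: (@pintegrable_ub _ _ C) => //.
  move=> v Dv; rewrite /margin; have := dC v Dv.
  have := dens_gt0 M g Dv; have := pay_ge0 g Dv.
  by have /prod_rangeP/andP[] := Dv; nra.
have := pintegrable_fin (core_pintegrable (employer g) g cO).
rewrite fin_numE => /andP[]; rewrite -ltNye => + _.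
rewrite (@pint_eq _ _ (margin g))//.
  exact: measurable_surplus fO.
by apply: aa_mono (employed g) => v _ []; rewrite /surplus /margin => ->.
Qed.

Lemma profit_employer g : profit M (O (employer g)) =
  ((mass M g)%:E * pint (margin g))%E.
Proof.
have fO := cO.1.1 (employer g).
rewrite (profit_single (g := g) fO).
  congr (_ * _)%E; apply: pint_eq; first exact: measurable_surplus fO.
    exact: pintegrable_measurable (margin_integrable g).
  by apply: aa_mono (employed g) => v _ []; rewrite /surplus /margin => ->.
apply: aa_mono (employed (other_group g)) => v _ [_ + _].
by rewrite employer_other other_firmK.
Qed.

(** The limiting gain of a poacher who leaves aside the types that are paid their productivity or
    more. *)
Definition clipped_margin g (v : R) := Num.max (v - pay g v) 0 * dens M g v.

Lemma clipped_margin_integrable g : pintegrable (clipped_margin g).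
Proof.
apply: pintegrable_mul_dens.
  by apply: measurable_maxr => //; exact: measurable_funB.
move=> v Dv; rewrite le_max lexx orbT ge_max ler01 andbT /=.
by have /prod_rangeP/andP[] := Dv; have := pay_ge0 g Dv; lra.
Qed.

(* A firm that offers group [g] slightly more than its pay wherever that pay is
   below productivity hires one group only, so the deviation respects EPSW. *)
Lemma profit_ge_clipped k g :
  ((mass M g)%:E * pint (clipped_margin g) <= profit M (O k))%E.
Proof.
have iq := clipped_margin_integrable g.
have pk0 := core_profit_ge0 k cO.
have [pkoo|pkoo] := eqVneq (profit M (O k)) +oo%E; first by rewrite pkoo leey.
have pk_fin : profit M (O k) \is a fin_num.
  by rewrite ge0_fin_numE// ltey.
pose h (e : R) g' (v : R) :=
  if same_group g g' && (pay g v < v) then dens M g v else 0.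
(* A raise proportional to the margin stays below productivity and scales the gain by exactly
   [1 - e]; a constant raise would turn small margins into losses. *)
pose w (e : R) (g' : group) (v : R) := (1 - e) * pay g v + e * v.
have dev e : 0 < e -> e < 1 ->
    (profit M (trim (h e) (w e)) <= profit M (O k))%E.
  move=> e0 e1; apply: (core_deviation cO).
  - move=> g'; apply: measurable_if => //; last exact: dens_measurable.
    by case: same_group => //=; apply: measurable_fun_ltr.
  - move=> g'; apply: measurable_funD; apply: measurable_funM => //.
  - move=> g' v Dv; rewrite /h; case: ifP => [/andP[/same_groupP <- _]|_].
      by rewrite lexx ltW// dens_gt0.
    by rewrite lexx ltW// dens_gt0.
  - move=> g' v Dv; have := pay_ge0 g Dv; have /prod_rangeP/andP[] := Dv.
    by rewrite /w; nra.
  - move=> _; apply: (@EPSW_single _ _ g) => v _ /=; rewrite /h.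
    by case: (g).
  - move=> g'; apply: aa_mono (employed g) => v Dv [hg _ wg].
    rewrite /h; case: ifP; last by rewrite ltxx.
    case/andP => /same_groupP <- pv _.
    have : pay g v < w e g v by rewrite /w; nra.
    rewrite /pay => wv; have w0 := pay_ge0 g Dv.
    (* The first blocking condition holds for either firm: one of the two current wages is [pay],
       the other is 0 by convention. *)
    have [->|->] := firm_cases k (employer g).
      constructor 1; split; first exact: ltW.
      rewrite wg; exact: le_lt_trans w0 wv.
    constructor 1; rewrite other_firmK; split=> //.
    by rewrite wg; apply: ltW; exact: le_lt_trans w0 wv.
have mh e g' : measurable_fun (prod_range R) (h e g').
  apply: measurable_if => //; last exact: dens_measurable.
  by case: same_group => //=; apply: measurable_fun_ltr.
have devE e : profit M (trim (h e) (w e)) =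
    ((mass M g)%:E * ((1 - e)%:E * pint (clipped_margin g)))%E.
  have surplusE g' : surplus (trim (h e) (w e)) g' =
      fun v => if same_group g g' then (1 - e) * clipped_margin g v else 0.
    apply/funext => v; rewrite surplus_trim /h /w /clipped_margin.
    case: same_group => /=; last by rewrite mulr0.
    case: ltP => pv; first by rewrite (max_idPl _) ?subr_ge0 ?ltW//; ring.
    by rewrite (max_idPr _) ?subr_le0// mul0r !mulr0.
  rewrite profitE !surplusE -(pintZ (1 - e) iq).
  have pint0 : pint (fun=> 0) = 0%E :> \bar R by exact: pint_cst.
  by case: (g) => /=; rewrite pint0 mule0 ?adde0 ?add0e.
move: pk0 dev; rewrite -(fineK pk_fin) lee_fin.
move: (fine (profit M (O k))) => p p0 dev.
have {}dev e : 0 < e -> e < 1 ->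
    (1 - e) * (mass M g * fine (pint (clipped_margin g))) <= p.
  move=> e0 e1; have := dev e e0 e1; rewrite devE -(fineK (pintegrable_fin iq)).
  by rewrite -!EFinM lee_fin mulrCA.
rewrite -(fineK (pintegrable_fin iq)) -EFinM lee_fin.
move: (mass M g * _) dev => q dev; rewrite leNgt; apply/negP => lt.
(* This [e] makes [(1 - e) * q] the midpoint of [p] and [q], which exceeds [p]. *)
have e0 : 0 < (q - p) / (2 * q) by rewrite divr_gt0; lra.
have e1 : (q - p) / (2 * q) < 1 by rewrite ltr_pdivrMr; lra.
have := dev _ e0 e1; rewrite mulrBl mul1r.
have -> : (q - p) / (2 * q) * q = (q - p) / 2 by field; lra.
lra.
Qed.

Lemma seg_core_stats : exists p : R,
  [/\ 0 <= p,
      forall k, profit M (O k) = p%:E,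
      forall g, AW O g = (mean_prod M g - p / mass M g)%:E
    & p = 0 -> forall g, for_almost_all (fun v => pay g v = v)].
Proof.
pose s g := fine (pint (margin g)).
pose q g := fine (pint (clipped_margin g)).
have sE g : pint (margin g) = (s g)%:E.
  by rewrite fineK// (pintegrable_fin (margin_integrable g)).
have qE g : pint (clipped_margin g) = (q g)%:E.
  by rewrite fineK// (pintegrable_fin (clipped_margin_integrable g)).
have sq_le g v : prod_range R v ->
    margin g v <= clipped_margin g v.
  by move=> Dv; rewrite ler_wpM2r ?le_max ?lexx// ltW// dens_gt0.
have sq g : s g <= q g.
  rewrite -lee_fin -sE -qE; apply: pint_le.
  - exact: pintegrable_measurable (margin_integrable g).
  - exact: pintegrable_measurable (clipped_margin_integrable g).
  - exact/aa_all/sq_le.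
(* Together with [s <= q] this makes the weighted [q] and [s] of both groups bound one another, so
   all four coincide. The equality [q g = s g] is what rules out pay above productivity. *)
have qs g g' : mass M g * q g <= mass M g' * s g'.
  rewrite -lee_fin !EFinM -qE -sE -profit_employer; exact: profit_ge_clipped.
have m0 := mass_gt0 M.
have ss g g' : mass M g * s g = mass M g' * s g'.
  have := qs g g'; have := qs g' g; have := sq g; have := sq g'.
  by have := m0 g; have := m0 g'; nra.
have qsE g : q g = s g by have := qs g g; have := sq g; have := m0 g; nra.
have q0 g : 0 <= q g.
  rewrite -lee_fin -qE; apply: pint_ge0.
    exact: pintegrable_measurable (clipped_margin_integrable g).
  apply: aa_all => v Dv; rewrite mulr_ge0 ?le_max ?lexx ?orbT//.
  by rewrite ltW// dens_gt0.
have pay_le g : for_almost_all (fun v => pay g v <= v).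
  have := pint_le_eq (margin_integrable g) (clipped_margin_integrable g)
    (sq_le g); rewrite sE qE qsE => /(_ (lexx _)).
  apply: aa_mono => v Dv; have d0 := dens_gt0 M g Dv.
  move=> /(mulIf (lt0r_neq0 d0)) => eq.
  by rewrite -subr_ge0 eq le_max lexx orbT.
exists (mass M GA * s GA); split.
- by rewrite -qsE mulr_ge0// ltW.
- move=> k; have [g ->] := employer_ex k.
  by rewrite profit_employer sE -EFinM (ss g GA).
- move=> g; rewrite (ss GA g) mulrC mulKf ?gt_eqF// (AW_paid g cO.1).
  transitivity (pint ((fun v => v * dens M g v) \-
      (margin g))); last first.
    rewrite pintB ?pint_vdens ?sE//; first exact: pintegrable_vdens.
    exact: margin_integrable.
  apply: pint_eq; first exact: measurable_paid cO.1.
    apply: measurable_funB.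
      exact: pintegrable_measurable (pintegrable_vdens M g).
    exact: pintegrable_measurable (margin_integrable g).
  apply: aa_mono (employed g) => v _; rewrite /margin /pay /=.
  by case: (employer g) => /= -[-> -> ->]; ring.
(* At zero profit the nonnegative clipped margin has integral 0, so pay is not below productivity
   either. *)
- move=> s0 g; have {}s0 : s g = 0.
    have := m0 g; have := ss GA g; rewrite s0 => /esym/eqP.
    by rewrite mulf_eq0 => /predU1P[->|/eqP//]; rewrite ltxx.
  have i0 : pintegrable (cst (0 : R)).
    by apply: (@pintegrable_bounded _ _ 0) => // v _; rewrite lexx.
  have := pint_le_eq i0 (clipped_margin_integrable g).
  rewrite qE qsE s0 pint_cst => /(_ _ (lexx _)) h.
  apply: aa_mono2 (pay_le g) (h _) => [v Dv pv /= /esym/eqP|v Dv].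
    rewrite mulf_eq0 (gt_eqF (dens_gt0 M g Dv)) orbF (max_idPl _) ?subr_ge0//.
    by rewrite subr_eq0 => /eqP.
  by rewrite mulr_ge0 ?le_max ?lexx ?orbT// ltW// dens_gt0.
Qed.

End SegregatedCore.

(** * A continuum of core outcomes under EPSW *)

Section Segregated.
Variables (R : realType) (M : market R).
Implicit Types (o : firm_outcome R) (g : group) (i j k : firm).
Implicit Types (m : group -> R -> R).

Definition hires k g : bool :=
  match k, g with Firm1, GA | Firm2, GB => true | _, _ => false end.

(* Firm 1 hires group A and firm 2 group B, earning the margin [m g v] on each
   worker of type [(g, v)]. *)
Definition seg_outcome m : outcome R := fun k =>
  trim (fun g v => if hires k g then dens M g v else 0)
       (fun g v => if hires k g then v - m g v else 0).

Definition admissible_margin m :=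
  forall g, measurable_fun (prod_range R) (m g) /\
    forall v, prod_range R v -> 0 <= m g v <= v.

Lemma seg_outcome_is_outcome b m : admissible_margin m ->
  is_outcome b M (seg_outcome m).
Proof.
move=> am; split=> [k|g v Dv]; last first.
  by case: g => /=; rewrite ?addr0 ?add0r.
apply: trim_is_firm_outcome.
- by move=> g; case: hires => //; exact: dens_measurable.
- move=> g; case: hires => //; apply: measurable_funB => //; exact: (am g).1.
- move=> g v Dv; have := dens_gt0 M g Dv.
  by case: hires => d0; rewrite ?lexx ltW.
- move=> g v Dv; case: hires => //; have /andP[_] := (am g).2 v Dv.
  by rewrite subr_ge0.
- move=> _; apply: (@EPSW_single _ _ (if k is Firm1 then GA else GB)).
  by case: k.
Qed.

Lemma seg_outcome_surplus m k g v : surplus (seg_outcome m k) g v =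
  if hires k g then m g v * dens M g v else 0.
Proof.
by rewrite surplus_trim; case: hires; rewrite ?mulr0// opprB addrCA subrr addr0.
Qed.

Lemma seg_outcome_profit m k : admissible_margin m ->
  profit M (seg_outcome m k) =
  (let g := if k is Firm1 then GA else GB in
   (mass M g)%:E * pint (fun v => (m g v * dens M g v)%R))%E.
Proof.
move=> am; have [fO _] := seg_outcome_is_outcome true am.
pose g := if k is Firm1 then GA else GB.
rewrite (profit_single (g := g) (fO k)).
  rewrite /= -/g; congr (_ * pint _)%E; apply/funext => v.
  by rewrite seg_outcome_surplus /g; case: k {g}.
by apply: aa_all => v _; rewrite /g; case: k {g}.
Qed.

(** Every type is fully employed by one firm. Conditions that avoid matching the incumbent's wage
    would require [h + d <= d], impossible for [h > 0]. *)
Lemma seg_outcome_undercut b m j o : admissible_margin m ->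
  is_firm_outcome b M o -> blocks M (seg_outcome m) j o ->
  forall g, for_almost_all (fun v =>
    0 < hired o g v -> v - m g v <= wage o g v).
Proof.
move=> am [_ ho _] [_ /[swap] g /(_ g)]; apply: aa_mono => v Dv H h0.
have := dens_gt0 M g Dv; have [_ _ w0 _] := ho g v Dv.
move: H; case: j; case: g h0 w0 => /= h0 w0 H d0;
  rewrite ?eqxx ?(gt_eqF d0) in H;
  case: H => [[? ?]|[? ?]|[? ?]|?]; lra.
Qed.

Lemma surplus_le_margin b m j o : admissible_margin m ->
  is_firm_outcome b M o -> blocks M (seg_outcome m) j o ->
  forall g, for_almost_all (fun v => surplus o g v <= m g v * dens M g v).
Proof.
move=> am fo bo g; have [_ ho _] := fo.
apply: aa_mono (seg_outcome_undercut am fo bo g) => v Dv.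
have [h0 hd _ _] := ho g v Dv; have /andP[m0 _] := (am g).2 v Dv.
have d0 := dens_gt0 M g Dv.
move: (h0); rewrite le_eqVlt /surplus => /predU1P[<- _|hp /(_ hp) wv].
  by rewrite mulr0 mulr_ge0// ltW.
apply: (@le_trans _ _ (m g v * hired o g v)); last exact: ler_wpM2l.
by rewrite ler_pM2r//; lra.
Qed.

Lemma measurable_margin_dens m g : admissible_margin m ->
  measurable_fun (prod_range R) (fun v => m g v * dens M g v).
Proof. by move=> am; apply: measurable_mul_dens; exact: (am g).1. Qed.

(** With zero margins no offer that attracts workers earns anything. *)
Lemma competitive_core_without_EPSW :
  core false M (seg_outcome (fun _ => cst 0)).
Proof.
have am : admissible_margin (fun _ => cst (0 : R)).
  by move=> g; split=> // v /prod_rangeP/andP[v0 _]; rewrite /= lexx.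
have pint0 : pint (fun=> 0 : R) = 0%E by exact: pint_cst.
split; first exact: seg_outcome_is_outcome.
move=> j o fo bo; have [lt _] := bo.
have le0 g : (pint (surplus o g) <= 0)%E.
  rewrite -[leRHS]pint0; apply: pint_le => //.
    exact: measurable_surplus fo.
  by apply: aa_mono (surplus_le_margin am fo bo g) => v _; rewrite /= mul0r.
move: lt; rewrite seg_outcome_profit//= (_ : pint _ = 0%E); last first.
  by rewrite -[RHS]pint0; congr pint; apply/funext => v; rewrite mul0r.
rewrite mule0 ltNge profitE => /negP; apply.
by rewrite adde_le0// mule_ge0_le0// lee_fin ltW// mass_gt0.
Qed.

(* Profits from the two groups cannot be combined: A workers on whom an offer
   earns are paid less than [c], and B workers on whom it earns are paid at least
   [c'], against EPSW. *)
Lemma seg_outcome_core m (p c c' : R) : admissible_margin m -> c < c' ->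
  (forall v, prod_range R v -> c <= v -> m GA v = 0) ->
  (forall v, prod_range R v -> c' <= v - m GB v \/ m GB v = 0) ->
  (forall g,
    ((mass M g)%:E * pint (fun v => (m g v * dens M g v)%R) = p%:E)%E) ->
  core true M (seg_outcome m).
Proof.
move=> am cc' mA mB mp; split; first exact: seg_outcome_is_outcome.
move=> j o fo bo; have [lt _] := bo.
have {}lt : (p%:E < profit M o)%E.
  by move: lt; rewrite seg_outcome_profit//= mp.
have le_p g : ((mass M g)%:E * pint (surplus o g) <= p%:E)%E.
  rewrite -(mp g) lee_pmul2l ?lte_fin ?mass_gt0//.
  apply: pint_le; [exact: measurable_surplus fo|exact: measurable_margin_dens|].
  exact: (surplus_le_margin am fo bo g).
have [mo ho /(_ isT)] := fo; apply.
(* Each group alone yields at most [p], so a profit above [p] needs a positive contribution from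
   both. *)
have S_gt0 g : (0 < pint (surplus o g))%E.
  rewrite ltNge; apply/negP => le0; move: lt; rewrite ltNge => /negP; apply.
  have mle0 : ((mass M g)%:E * pint (surplus o g) <= 0)%E.
    by rewrite mule_ge0_le0// lee_fin ltW// mass_gt0.
  rewrite profitE; case: g le0 mle0 => _ mle0.
    by rewrite -[leRHS]add0e leeD.
  by rewrite -[leRHS]adde0 leeD.
pose V g := prod_range R `&` [set v | (0 < surplus o g v) &&
   ((v - m g v <= wage o g v))].
have mV g : measurable (V g).
  rewrite /V (_ : [set v | _] = (fun v => (0 < surplus o g v) &&
     (v - m g v <= wage o g v)) @^-1` [set true]); last first.
    by apply/seteqP; split=> v /=; case: (_ && _).
  have [_ mw] := mo g; have [mm _] := am g.
  apply: measurable_and => //.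
  - by apply: measurable_fun_ltr => //; exact: measurable_surplus fo.
  - by apply: measurable_fun_ler => //; exact: measurable_funB.
  - exact: measurable_itv.
have V0 g : (0 < @lebesgue_measure R (V g))%E.
  rewrite lt0e measure_ge0 andbT; apply/eqP => Vnull.
  have nV : for_almost_all (fun v => ~ V g v).
    have : (@lebesgue_measure R).-negligible (V g).
      exact: ((negligibleP (@lebesgue_measure R) (mV g)).2 Vnull).
    by apply: negligibleS => v /= /not_implyP[_ /contrapT].
  have := S_gt0 g; rewrite ltNge => /negP; apply.
  rewrite -[leRHS](pint_cst 0); apply: pint_le => //.
    exact: measurable_surplus fo.
  apply: aa_mono2 nV (seg_outcome_undercut am fo bo g) => v Dv nVv hw.
  rewrite leNgt; apply/negP => s0; apply: nVv; split=> //=; rewrite s0 /=.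
  apply: hw; have [h0 _ _ _] := ho g v Dv; rewrite lt_neqAle h0 andbT.
  by apply/eqP => h_eq; move: s0; rewrite /surplus -h_eq mulr0 ltxx.
have V_hired g v : V g v -> [/\ prod_range R v, 0 < hired o g v,
    wage o g v < v & v - m g v <= wage o g v].
  move=> [Dv /andP[s0 wv]]; have [h0 _ _ _] := ho g v Dv.
  have hp : 0 < hired o g v.
    rewrite lt_neqAle h0 andbT; apply/eqP => h_eq.
    by move: s0; rewrite /surplus -h_eq mulr0 ltxx.
  by split=> //; move: s0; rewrite /surplus pmulr_lgt0// subr_gt0.
exists GA, (V GA), (V GB); split.
- by split=> // v [].
- by split=> // v [].
- by move=> v /V_hired[].
- by move=> v /V_hired[].
(* On [V] the wage lies in [[v - m g v, v[], so the margin is positive there. An A wage above [c]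
   would give [v > c] and margin 0; for B a positive margin leaves only [c' <= v - m GB v]. *)
apply: (@le_lt_trans _ _ c%:E).
  apply: ge_ereal_sup => _ [v /V_hired[Dv _ wv mw] <-]; rewrite lee_fin.
  rewrite leNgt; apply/negP => cw.
  have : m GA v = 0 by apply: mA => //; lra.
  lra.
apply: (@lt_le_trans _ _ c'%:E); first by rewrite lte_fin.
apply: le_ereal_inf_tmp => _ [v /V_hired[Dv _ wv mw] <-]; rewrite lee_fin.
case: (mB v Dv) => [|m0]; first by move/le_trans; apply.
lra.
Qed.

Lemma competitive_core : core true M (seg_outcome (fun _ => cst 0)).
Proof.
(* All margins vanish, so any thresholds [c < c'] would do. *)
apply: (@seg_outcome_core _ 0 0 1) => //.
- by move=> g; split=> // v /prod_rangeP/andP[v0 _]; rewrite /= lexx.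
- by move=> v _; right.
- move=> g; rewrite (_ : pint _ = 0%E) ?mule0//.
  have pint0 : pint (fun=> 0 : R) = 0%E by exact: pint_cst.
  by rewrite -[RHS]pint0; congr pint; apply/funext => v; rewrite mul0r.
Qed.

(** Markdowns at full strength: A workers below 1/3 are paid 0, B workers above 2/3 are paid 2/3.
    Scaling by a factor in [[0, 1]] keeps exploited A workers below 1/3 and exploited B wages at
    least 2/3, which separates the thresholds of [seg_outcome_core]. *)
Definition base g (v : R) : R :=
  if g is GA then (if v < 1 / 3 then v else 0)
  else (if 2 / 3 < v then v - 2 / 3 else 0).

Lemma base01 g v : prod_range R v -> 0 <= base g v <= v.
Proof.
move/prod_rangeP/andP => [v0 v1].
by case: g => /=; case: ltP => ?; apply/andP; split; lra.
Qed.

Lemma measurable_base g : measurable_fun (prod_range R) (base g).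
Proof.
case: g => /=; apply: measurable_if => //; try exact: measurable_fun_ltr.
exact: measurable_funB.
Qed.

Lemma base_pint g : exists2 K : R,
  0 < K & pint (fun v => base g v * dens M g v) = K%:E.
Proof.
have b1 v : prod_range R v -> 0 <= base g v <= 1.
  move=> Dv; have /andP[b0 bv] := base01 g Dv.
  have /prod_rangeP/andP[_ v1] := Dv.
  by rewrite b0; lra.
have mb := measurable_base g.
case: g mb b1 => mb b1.
- apply: (@pint_mul_dens_gt0 _ _ _ 0 (1 / 3)) => //; try lra.
  by move=> v /andP[v0 v1] /=; rewrite v1.
- apply: (@pint_mul_dens_gt0 _ _ _ (2 / 3) 1) => //; try lra.
  by move=> v /andP[v0 v1] /=; rewrite v0 subr_gt0.
Qed.

Lemma core_profit_level : exists2 c : R, 0 < c &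
  forall p, 0 < p -> p < c -> exists O, core true M O /\
    forall k, profit M (O k) = p%:E.
Proof.
have [KA KA0 KAE] := base_pint GA; have [KB KB0 KBE] := base_pint GB.
pose K g := if g is GA then KA else KB.
have KE g : pint (fun v => base g v * dens M g v) = (K g)%:E by case: g.
have K0 g : 0 < mass M g * K g by rewrite mulr_gt0 ?mass_gt0//; case: g.
exists (Num.min (mass M GA * K GA) (mass M GB * K GB)).
  by rewrite lt_min !K0.
move=> p p0; rewrite lt_min => /andP[pA pB].
(* The factor at which group [g] yields exactly [p]; the bound on [p] keeps it at most 1 for both
   groups. *)
pose s g := p / (mass M g * K g).
have s01 g : 0 <= s g <= 1.
  apply/andP; split; first by apply: divr_ge0; exact: ltW.
  by rewrite ler_pdivrMr// mul1r; case: g; exact: ltW.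
pose m g v := s g * base g v.
have mE g v : prod_range R v -> 0 <= m g v <= base g v.
  move=> /(base01 g)/andP[b0 _]; have /andP[s0 s1] := s01 g.
  by rewrite /m mulr_ge0//= ler_piMl.
have am : admissible_margin m.
  move=> g; split.
    by apply: measurable_funM => //; exact: measurable_base.
  move=> v Dv; have /andP[-> mb] := mE g v Dv.
  by have /andP[_] := base01 g Dv; exact: le_trans.
have mp g : ((mass M g)%:E * pint (fun v => (m g v * dens M g v)%R) = p%:E)%E.
  rewrite (_ : (fun v => _) = fun v => s g * (base g v * dens M g v));
    last by apply/funext => v; rewrite mulrA.
  rewrite pintZ.
    rewrite KE -!EFinM mulrCA /s divfK ?gt_eqF//.
  apply: pintegrable_mul_dens; first exact: measurable_base.
  move=> v Dv; have /andP[-> bv] := base01 g Dv.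
  by have /prod_rangeP/andP[_ v1] := Dv; exact: le_trans v1.
exists (seg_outcome m); split; last first.
  by move=> k; rewrite seg_outcome_profit//= mp.
apply: (@seg_outcome_core _ p (1 / 3) (2 / 3)) => //; first lra.
- by move=> v _ cv; rewrite /m /= ltNge cv mulr0.
- move=> v Dv; have /andP[_] := mE GB v Dv.
  rewrite /m /=; case: ltP => cv; last by rewrite mulr0; right.
  by move=> ?; left; lra.
Qed.

End Segregated.

(** * Wage gap, wage ratio and equivalence in terms of firm profit *)

Section FullySegregatedMarket.
Variables (R : realType) (M : market R).
Hypothesis hseg : forall O : outcome R, core true M O -> full_segregation M O.
Implicit Types (O : outcome R) (g : group) (i k : firm).

Definition competitive : outcome R := seg_outcome M (fun _ => cst 0).

Lemma competitive_equiv O i : core true M O ->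
  for_almost_all (fun v =>
    hired (O i) GA v = dens M GA v /\
    hired (O (other_firm i)) GB v = dens M GB v) ->
  (forall g, for_almost_all (fun v => pay O i g v = v)) ->
  equivalent competitive O.
Proof.
move=> cO sO payE.
(* Firm [k'] in [O] has the role of firm [k] in [competitive]. If firm 2 employs group A the roles
   are swapped, which is the relabelling case of [equivalent]. *)
have firm_equiv_of k k' : (forall g, k' =
    if hires k g then employer i g else other_firm (employer i g)) ->
    firm_equiv (competitive k) (O k').
  move=> kE g; apply: aa_mono2 (employed cO sO g) (payE g) => v Dv.
  move=> [hg h0 w0] pv; have d0 := dens_gt0 M g Dv.
  rewrite (kE g) /competitive /=; case: hires.
    by rewrite hg -[wage _ _ _]/(pay O i g v) pv gt_eqF//= subr0.
  by rewrite h0 w0 eqxx.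
by case: i sO payE firm_equiv_of => sO payE eqv; [left|right] => k; apply: eqv;
  case: k; case.
Qed.

Lemma core_stats O : core true M O -> exists p : R,
  [/\ forall k, profit M (O k) = p%:E,
      forall g, AW O g = (mean_prod M g - p / mass M g)%:E,
      0 <= p, p <= mean_prod M GB
    & p = 0 -> equivalent competitive O].
Proof.
move=> cO; have [i sO] := hseg cO.
have [p [p0 profitp AWp payE]] := seg_core_stats cO sO.
exists p; split=> //; last by move=> /payE; exact: competitive_equiv.
have : (0 <= AW O GB)%E.
  rewrite (AW_paid GB cO.1); apply: pint_ge0; first exact: measurable_paid cO.1.
  have [_ h1 _] := cO.1.1 Firm1; have [_ h2 _] := cO.1.1 Firm2.
  apply: aa_all => v Dv; have [? _ ? _] := h1 GB v Dv.
  by have [? _ ? _] := h2 GB v Dv; rewrite addr_ge0// mulr_ge0.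
by rewrite AWp lee_fin /= divr1 subr_ge0.
Qed.

(** On both cores [X] is [phi] of the common profit, with [p = 0] throughout the core without EPSW.
    Strict monotonicity makes [phi p = phi 0] force [p = 0], which characterizes [competitive] up to
    equivalence. Monotonicity is only asked up to [mean_prod M GB], the largest profit compatible
    with nonnegative pay of group B. *)
Lemma core_statistic (X : outcome R -> \bar R)
    (Phi : \bar R -> \bar R -> \bar R)
    (phi := fun p : R => Phi (mean_prod M GA - p / beta M)%:E
                             (mean_prod M GB - p)%:E) :
  (forall O, X O = Phi (AW O GA) (AW O GB)) ->
  (forall p p', 0 <= p -> p < p' -> p' <= mean_prod M GB ->
    (phi p < phi p')%E) ->
  unique_core_without_EPSW_level M X /\ higher_iff_higher_firm_profit M X.
Proof.
move=> XE phi_lt.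
have X_false O : core false M O -> X O = phi 0.
  by move=> cO; rewrite XE !(core_without_EPSW_AW _ cO) /phi mul0r !subr0.
have X_true O p : (forall g, AW O g = (mean_prod M g - p / mass M g)%:E) ->
    X O = phi p.
  by move=> AWp; rewrite XE !AWp /= divr1.
have X_competitive : X competitive = phi 0.
  exact/X_false/competitive_core_without_EPSW.
split.
- exists competitive; split.
  + exact: competitive_core.
  + split; first by exists competitive; exact: competitive_core_without_EPSW.
    by move=> O0 /X_false ->.
  + move=> O cO [_ /(_ _ (competitive_core_without_EPSW M))].
    have [p [_ /X_true -> p0 pB peq]] := core_stats cO.
    rewrite X_competitive => phi_eq; apply: peq.
    move: p0; rewrite le_eqVlt => /predU1P[//|p0].
    by have := phi_lt _ _ (lexx _) p0 pB; rewrite phi_eq ltxx.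
  + move=> O cO neq; have [p [_ /X_true -> p0 pB peq]] := core_stats cO.
    rewrite X_competitive phi_lt// lt_neqAle p0 andbT.
    by apply/eqP => /esym/peq.
- move=> O O' cO cO' i i'.
  have [p [profitp /X_true -> p0 pB _]] := core_stats cO.
  have [p' [profitp' /X_true -> p'0 p'B _]] := core_stats cO'.
  rewrite profitp profitp' lte_fin; split; last by move=> pp'; exact: phi_lt.
  move=> lt; rewrite ltNge le_eqVlt; apply/negP => /predU1P[eqp|ltp].
    by move: lt; rewrite eqp ltxx.
  by move: (lt_trans lt (phi_lt _ _ p0 ltp p'B)); rewrite ltxx.
Qed.

(** Here [phi p = E_A - E_B + p * (1 - 1 / beta)]. *)
Lemma gap_statistic : 1 < beta M ->
  unique_core_without_EPSW_level M (@wage_gap R) /\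
  higher_iff_higher_firm_profit M (@wage_gap R).
Proof.
move=> b1; apply: (core_statistic (Phi := fun a b => (a - b)%E)) => //.
move=> p p' p0 pp' _.
rewrite -!EFinB lte_fin.
have b0 : 0 < beta M by lra.
have : (p' - p) / beta M < p' - p by rewrite ltr_pdivrMr// ltr_pMr//; lra.
by rewrite mulrBl; lra.
Qed.

Lemma ratio_statistic : mean_prod M GB < beta M * mean_prod M GA ->
  unique_core_without_EPSW_level M (@wage_ratio R) /\
  higher_iff_higher_firm_profit M (@wage_ratio R).
Proof.
move=> BA; apply: (core_statistic (Phi := fun a b =>
  if b != 0%E then (a / b)%E else if (0 < a)%E then +oo%E else 0%E)) => //.
move=> p p' p0 pp' p'B.
have b0 : 0 < beta M := mass_gt0 M GA.
have a_gt q : q <= mean_prod M GB -> 0 < mean_prod M GA - q / beta M.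
  by move=> qB; rewrite subr_gt0 ltr_pdivrMr// mulrC; exact: le_lt_trans BA.
have pB : p < mean_prod M GB by lra.
rewrite !eqe !subr_eq0 (gt_eqF pB) /= inver subr_eq0 (gt_eqF pB).
(* At [p' = E_B] group B is paid nothing while the pay of A is still positive, so the ratio is
   [+oo]. *)
have [p'E|p'ne] := eqVneq (mean_prod M GB) p'.
  by rewrite lte_fin a_gt// -EFinM ltry.
rewrite /= inver subr_eq0 (negbTE p'ne) -!EFinM lte_fin.
have p'B' : p' < mean_prod M GB by rewrite lt_neqAle p'B andbT eq_sym.
rewrite ltr_pdivrMr ?subr_gt0// mulrAC ltr_pdivlMr ?subr_gt0//.
move: BA; rewrite -ltr_pdivrMl// mulrC => BA.
(* After cross-multiplication the terms in [p * p'] cancel, and the remaining factor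
   [E_A - E_B / beta] is positive by hypothesis. *)
rewrite -subr_gt0 (_ : _ - _ =
  (p' - p) * (mean_prod M GA - mean_prod M GB / beta M)).
  by rewrite mulr_gt0// subr_gt0.
by move: (beta M)^-1 => e; ring.
Qed.

(** Firm profit separates equivalence classes: it ignores null sets, and relabelling is harmless
    since both firms of each chosen outcome earn the same. *)
Lemma core_continuum : exists C : set (outcome R),
  [/\ (C #= [set: R])%card,
      forall O, C O -> core true M O
    & forall O O', C O -> C O' -> O <> O' -> ~ equivalent O O'].
Proof.
have [c c0 level] := core_profit_level M.
(* An injection of the whole line into the interval of attainable profits between 0 and [c]. *)
pose p (x : R) := c / (1 + expR x).
have p_itv x : 0 < p x /\ p x < c.
  have ex := expR_gt0 x; split; first by rewrite divr_gt0//; lra.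
  by rewrite ltr_pdivrMr ?ltr_pMr//; lra.
pose F x := projT1 (cid (level (p x) (p_itv x).1 (p_itv x).2)).
have F_core x : core true M (F x) by rewrite /F; case: cid => O [].
have F_profit x k : profit M (F x k) = (p x)%:E.
  by rewrite /F; case: cid => O [].
have p_inj : injective p.
  move=> x y; rewrite /p; have ex := expR_gt0 x; have ey := expR_gt0 y.
  move/(mulfI (lt0r_neq0 c0))/invr_inj/addrI; exact: expR_inj.
have F_inj : injective F.
  move=> x y Fxy; apply: p_inj; apply: EFin_inj.
  by rewrite -!(F_profit _ Firm1) Fxy.
exists (range F); split.
- by apply: inj_card_eq => x y _ _; exact: F_inj.
- by move=> _ [x _ <-].
- move=> _ _ [x _ <-] [y _ <-] neq eqv; apply: neq; congr F; apply: p_inj.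
  apply: EFin_inj; rewrite -(F_profit x Firm1).
  have fO k z := (F_core z).1.1 k.
  case: eqv => /(_ Firm1) e;
    by rewrite (profit_ae (fO _ _) (fO _ _) e) F_profit.
Qed.

End FullySegregatedMarket.

Theorem proposition3 (R : realType) (M : market R)
    (hseg : forall O : outcome R, core true M O -> full_segregation M O) :
  [/\ (* 1 *)
      exists C : set (outcome R),
        [/\ (C #= [set: R])%card,
            forall O, C O -> core true M O
          & forall O O', C O -> C O' -> O <> O' -> ~ equivalent O O'],
      (* 2 *)
      1 < beta M -> unique_core_without_EPSW_level M (@wage_gap R),
      (* 3 *)
      1 < beta M -> higher_iff_higher_firm_profit M (@wage_gap R)
    & (* 4 *)
      mean_prod M GB < beta M * mean_prod M GA ->
        unique_core_without_EPSW_level M (@wage_ratio R) /\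
        higher_iff_higher_firm_profit M (@wage_ratio R)].
Proof.
split.
- exact: core_continuum.
- by move=> /(gap_statistic hseg)[].
- by move=> /(gap_statistic hseg)[].
- exact: ratio_statistic.
Qed.
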